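(* Let $\Psi:[0,\ell(I)[\,\to\mathbb{R}_+$ and assume that the map $t\mapsto\Psi(t)/t$ is locally integrable on $[0,\ell(I)[$, and let $\Phi:[0,\ell(I)[\,\to\mathbb{R}_+$ satisfy $$\Phi(u)=\Psi(u)+\int_0^u\frac{\Psi(t)}{t}\,dt\qquad(u\in\,]0,\ell(I)[).$$ If $f:I\to\mathbb{R}$ is a continuous solution of $$\bigg|f(u)-\frac{1}{v-u}\int_u^v f\bigg|\le\Psi(v-u)\qquad(u,v\in I,\ u<v),$$ then $f$ is $\Phi$-Hölder on $I$.
   Context: $I$ is a nonempty open real interval and $\ell(I)\in\,]0,\infty]$ is its length; $\mathbb{R}_+=[0,\infty[$. A function on an interval is locally integrable if it has a finite Lebesgue integral over every compact subinterval of its domain (the value of $\Psi(t)/t$ at $t=0$ is irrelevant). The value $\Phi(0)\ge0$ is arbitrary. $f:I\to\mathbb{R}$ is $\Phi$-Hölder if $|f(x)-f(y)|\le\Phi(|x-y|)$ for all $x,y\in I$. *)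

(* Defs.v *)
From HB Require Import structures.
From mathcomp Require Import all_boot all_order all_algebra.
From mathcomp Require Import all_classical all_reals all_analysis.
Import Order.TTheory GRing.Theory Num.Theory.
Import numFieldNormedType.Exports.

Set Implicit Arguments.
Unset Strict Implicit.
Unset Printing Implicit Defensive.

Local Open Scope classical_set_scope.
Local Open Scope ring_scope.

(* Functions on an interval are represented by total functions R -> R, of which
   only the values on the interval are ever used. *)

(* The interval ]a, b[; the endpoints may be infinite. *)
Definition open_interval (R : realType) (a b : \bar R) : set R :=
  [set x | (a < x%:E)%E /\ (x%:E < b)%E].

(* The interval [0, l[. *)
Definition halfopen_from0 (R : realType) (l : \bar R) : set R :=
  [set t | 0 <= t /\ (t%:E < l)%E].

(* The measure is the completed one, i.e., integrable functions are only
   required to be Lebesgue measurable ([lebesgue_measure] would require them to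
   be Borel measurable). *)
Definition locally_integrable_on (R : realType) (D : set R) (g : R -> R) :=
  forall c d : R, `[c, d] `<=` D ->
    (@completed_lebesgue_measure R).-integrable `[c, d] (EFin \o g).

Definition holder_on (R : realType) (D : set R) (Phi f : R -> R) :=
  forall x y : R, D x -> D y -> `|f x - f y| <= Phi `|x - y|.

(* Main.v *)
(* For x < y in I let h(t) be the mean of f over [y - t, y].  Then
   t h'(t) = f(y - t) - h(t), so the hypothesis says exactly
   |h'(t)| <= Psi(t) / t.  As h(t) -> f(y) when t -> 0+, integrating over
   ]0, y - x] gives |h(y - x) - f(y)| <= \int_0^(y-x) Psi(t)/t dt, while the
   hypothesis at u = x, v = y gives |f(x) - h(y - x)| <= Psi(y - x). *)
Require Import Defs.
From HB Require Import structures.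
From mathcomp Require Import all_boot all_order all_algebra.
From mathcomp Require Import all_classical all_reals all_analysis.
From mathcomp Require Import measurable_realfun ring lra.
Import Order.TTheory GRing.Theory Num.Theory.
Import numFieldNormedType.Exports.

Local Open Scope classical_set_scope.
Local Open Scope ring_scope.

(* The identity map is measurable from the Caratheodory sigma-algebra to the
   Borel one and pushes the completed measure forward to [lebesgue_measure]. *)
Lemma ge0_integral_completed_lebesgue {R : realType}
    (D : set R) (f : R -> \bar R) :
  measurable D -> measurable_fun D f -> (forall x, D x -> (0 <= f x)%E) ->
  (\int[@completed_lebesgue_measure R]_(x in D) f x =
   \int[@lebesgue_measure R]_(x in D) f x)%E.
Proof.
move=> mD mf f0.
have mid : measurable_fun [set: caratheodory_type ((wlength idfun)^*)%mu]
    (id : _ -> measurableTypeR R).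
  by move=> _ B mB; rewrite setTI; exact: sub_caratheodory.
have := @ge0_integral_pushforward _ _ _ (measurableTypeR R) R _ mid
  (@completed_lebesgue_measure R) D f mD mf.
by rewrite preimage_id => <- // x /[1!inE]; exact: f0.
Qed.

Lemma integrable_completed_lebesgue {R : realType}
    (D : set R) (f : R -> \bar R) :
  measurable D -> (@lebesgue_measure R).-integrable D f ->
  (@completed_lebesgue_measure R).-integrable D f.
Proof.
move=> mD /integrableP[mf foo]; apply/integrableP; split.
  move=> mD' B mB; apply: sub_caratheodory; exact: mf.
rewrite ge0_integral_completed_lebesgue//; exact: measurableT_comp.
Qed.

(** Positive and negative parts reduce this to the nonnegative case. Continuous functions are Borel,
    so the fundamental theorem of calculus for [lebesgue_measure] becomes applicable to their
    integrals against the completed measure. *)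
Lemma integral_completed_lebesgue {R : realType}
    (D : set R) (f : R -> \bar R) :
  measurable D -> measurable_fun D f ->
  (\int[@completed_lebesgue_measure R]_(x in D) f x =
   \int[@lebesgue_measure R]_(x in D) f x)%E.
Proof.
move=> mD mf; rewrite integralE [RHS]integralE.
rewrite !ge0_integral_completed_lebesgue//.
- exact: measurable_funeneg.
- exact: measurable_funepos.
Qed.

Section primitive.
Context {R : realType} {f : R -> R} {c d : R}.
Hypothesis cf : {within `[c, d], continuous f}.
Notation mu := (@lebesgue_measure R).

Let F (z : R) : R := \int[mu]_(t in `[c, z]) f t.

Lemma continuous_itv_integrable : mu.-integrable `[c, d] (EFin \o f).
Proof. by apply: continuous_compact_integrable => //; exact: segment_compact. Qed.

(** Additivity leaves the integral over []u, v]], and the point [u] is null. This expresses the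
    means in the hypothesis on [f] through a primitive. *)
Lemma Rintegral_primitiveB (u v : R) : c <= u -> u < v -> v <= d ->
  \int[@completed_lebesgue_measure R]_(t in `[u, v]) f t = F v - F u.
Proof.
move=> cu uv vd.
have icv : mu.-integrable `[c, v] (EFin \o f).
  apply: integrableS continuous_itv_integrable => //.
  by apply: subset_itvl; rewrite bnd_simp.
have iuv : mu.-integrable `[u, v] (EFin \o f).
  by apply: integrableS icv => //; apply: subset_itvr; rewrite bnd_simp.
rewrite /F Rintegral_itvB//= ?bnd_simp ?ltW//.
rewrite Rintegral_itv_obnd_cbnd//; last first.
  by apply: integrableS iuv => //; apply: subset_itvr; rewrite bnd_simp.
rewrite /Rintegral integral_completed_lebesgue//.
by case/integrableP : iuv.
Qed.

Lemma is_derive_primitive (z : R) : c < z < d -> is_derive z 1 F (f z).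
Proof.
move=> /andP[cz zd].
have fz : {for z, continuous f}.
  have : {within `]c, d[, continuous f}.
    by apply: continuous_subspaceW cf; exact: subset_itv_oo_cc.
  rewrite continuous_open_subspace; last exact: itv_open.
  by apply; rewrite inE/= in_itv/= cz zd.
have [dF Fz] := continuous_FTC1_closed zd continuous_itv_integrable cz fz.
by apply: DeriveDef => //; rewrite -derive1E.
Qed.

End primitive.

(** The increment is the integral of the continuous [h'], whose absolute value is at most the
    integral of [|h'|]. Since [g] may be only Lebesgue measurable, the comparison with [g] takes
    place in the completed measure. *)
Lemma norm_increment_le_Rintegral {R : realType} (h h' g : R -> R) (r s : R) :
  r < s -> {in `[r, s], forall t : R, is_derive t 1 h (h' t)} ->
  {within `[r, s], continuous h'} ->
  (@completed_lebesgue_measure R).-integrable `[r, s] (EFin \o g) ->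
  {in `[r, s], forall t, `|h' t| <= g t} ->
  `|h s - h r| <= \int[@completed_lebesgue_measure R]_(t in `[r, s]) g t.
Proof.
move=> rs dh ch' ig h'g.
have ih' : (@lebesgue_measure R).-integrable `[r, s] (EFin \o h').
  by apply: continuous_compact_integrable => //; exact: segment_compact.
have ch t : t \in `[r, s] -> {for t, continuous h}.
  move=> /dh[dht _]; apply/differentiable_continuous.
  by rewrite -derivable1_diffP.
have := @continuous_FTC2 R h' h r s rs ch'.
move=> FTC.
have hrs : h s - h r = \int[@completed_lebesgue_measure R]_(t in `[r, s]) h' t.
  rewrite /Rintegral integral_completed_lebesgue//; last first.
    by case/integrableP : ih'.
  rewrite FTC//.
  - split.
    + by move=> t /subset_itv_oo_cc /dh[].
    + by apply/cvg_at_right_filter/ch; rewrite in_itv/= lexx ltW.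
    + by apply/cvg_at_left_filter/ch; rewrite in_itv/= lexx ltW.
  - by move=> t /subset_itv_oo_cc /dh[_]; rewrite derive1E.
have ich' := integrable_completed_lebesgue _ _ (measurable_itv _) ih'.
rewrite hrs; apply: le_trans (le_normr_Rintegral _ ich') _.
  exact: sub_caratheodory.
apply: le_Rintegral => //.
- exact: sub_caratheodory.
- exact: (integrable_abse ich').
Qed.

Section difference_quotient.
Context {R : realType} {F f : R -> R} {v : R}.

Let h (t : R) : R := t^-1 * (F v - F (v - t)).

(** Differentiating [t * h t = F v - F (v - t)] gives [h t + t * h' t = f (v - t)]. *)
Lemma is_derive_difference_quotient (t : R) : 0 < t ->
  is_derive (v - t) (1 : R) F (f (v - t)) ->
  is_derive t (1 : R) h ((f (v - t) - h t) / t).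
Proof.
move=> t0 dF.
have t_neq0 : t != 0 by rewrite gt_eqF.
have dvt : is_derive t (1 : R) (cst v - id) (0 - 1) by exact: is_deriveB.
have dFvt : is_derive t (1 : R) (F \o (cst v - id)) (f (v - t) * (0 - 1)).
  exact: is_derive1_comp.
have dV : is_derive t (1 : R) (fun s : R => s^-1) (- t ^- 2 *: 1).
  split; first by apply: derivableV => //; exact: derivable_id.
  by rewrite deriveV ?derive_id//; exact: derivable_id.
rewrite (_ : h = (fun s => s^-1) * (cst (F v) - (F \o (cst v - id))))//.
apply: is_derive_eq.
rewrite /h /GRing.scale /= !fctE /=; field; exact: t_neq0.
Qed.

Lemma cvg_difference_quotient : is_derive v (1 : R) F (f v) ->
  h t @[t --> 0^'+] --> f v.
Proof.
move=> [dF Fv].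
have cF : (fun s : R => s^-1 *: ((F \o shift v) (s *: (1 : R)) - F v)) @ 0^' --> f v.
  by rewrite -Fv; exact: dF.
(* With [s = - t], [h t] is the usual difference quotient of [F] at [v] with increment [s < 0], so
   the limit is the left derivative. *)
rewrite cvg_at_rightNP oppr0.
apply: cvg_trans (cvg_dnbhs_at_left cF).
apply: near_eq_cvg; near=> s.
by rewrite /h /= opprK invrN mulNr -mulrN opprB /GRing.scale/= mulr1 (addrC s).
Unshelve. all: by end_near. Qed.

End difference_quotient.

(** A finite endpoint is handled by a midpoint, an infinite one by a unit shift. *)
Lemma open_interval_widen {R : realType} {a b : \bar R} {x : R} :
  open_interval a b x ->
  (exists2 c, c < x & (a < c%:E)%E) /\ (exists2 d, x < d & (d%:E < b)%E).
Proof.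
move=> [ax xb]; split.
- case: a ax => [r| |]//; last by exists (x - 1); [rewrite gtrBl|exact: ltNyr].
  rewrite lte_fin => rx.
  by exists ((r + x) / 2); rewrite ?lte_fin (midf_lt rx).
- case: b xb => [r| |]//; last by exists (x + 1); [rewrite ltrDl|exact: ltry].
  rewrite lte_fin => xr.
  by exists ((x + r) / 2); rewrite ?lte_fin (midf_lt xr).
Qed.

Theorem theorem6p3 (R : realType) (a b : \bar R) (hab : (a < b)%E)
  (Psi Phi f : R -> R)
  (hPsi0 : forall t : R, halfopen_from0 (b - a)%E t -> 0 <= Psi t)
  (hPsi : locally_integrable_on (halfopen_from0 (b - a)%E)
            (fun t : R => Psi t / t))
  (hPhi0 : forall t : R, halfopen_from0 (b - a)%E t -> 0 <= Phi t)
  (hPhi : forall u : R, 0 < u -> (u%:E < b - a)%E ->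
     Phi u = Psi u +
       \int[@completed_lebesgue_measure R]_(t in `[0, u]) (Psi t / t))
  (hf : {within open_interval a b, continuous f})
  (hfPsi : forall u v : R, open_interval a b u -> open_interval a b v -> u < v ->
     `|f u - (v - u)^-1 * \int[@completed_lebesgue_measure R]_(t in `[u, v]) f t|
       <= Psi (v - u)) :
  holder_on (open_interval a b) Phi f.
Proof.
have width x y : open_interval a b x -> open_interval a b y ->
    ((y - x)%:E < b - a)%E.
  move=> [+ _] [_]; clear; case: a => [r| |]//; case: b => [s| |] /=;
    rewrite -?EFinB ?ltry ?lte_fin// => ? ?; lra.
move=> x y Ix Iy; wlog : x y Ix Iy / x <= y.
  by move=> H; case: (leP x y) => [|/ltW] ?; [|rewrite distrC (distrC x)]; exact: H.
(* For [x = y] only [Phi 0 >= 0] is needed; the formula for [Phi] covers [u > 0] alone. *)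
rewrite le_eqVlt => /predU1P[->|xy].
  rewrite !subrr normr0; apply: hPhi0; split => //.
  by rewrite -(subrr x); exact: width.
(* The compact interval [[c, d]] in I has [x] and [y] in its interior, so that the primitive based
   at [c] has two-sided derivatives at both points. *)
have [[c cx ac] _] := open_interval_widen Ix.
have [_ [d yd db]] := open_interval_widen Iy.
have Icd z : c <= z <= d -> open_interval a b z.
  move=> /andP[cz zd]; split; first by rewrite (lt_le_trans ac)// lee_fin.
  by rewrite (le_lt_trans _ db)// lee_fin.
have cf : {within `[c, d], continuous f}.
  by apply: continuous_subspaceW hf => z /=; rewrite in_itv/=; exact: Icd.
have hfo : {in `]c, d[%classic, continuous f}.
  rewrite -continuous_open_subspace; last exact: itv_open.
  by apply: continuous_subspaceW cf; exact: subset_itv_oo_cc.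
pose F z := \int[@lebesgue_measure R]_(t in `[c, z]) f t.
pose h t := t^-1 * (F y - F (y - t)).
pose J r s := \int[@completed_lebesgue_measure R]_(t in `[r, s]) (Psi t / t).
have hE u : c <= u < y ->
    (y - u)^-1 * \int[@completed_lebesgue_measure R]_(t in `[u, y]) f t = h (y - u).
  move=> /andP[cu uy]; rewrite (Rintegral_primitiveB cf)// ?ltW//.
  by rewrite /h subKr.
have fh (t : R) : 0 < t <= y - x -> `|f (y - t) - h t| <= Psi t.
  move=> /andP[t0 tL]; have yt : c <= y - t < y by lra.
  have /(_ _ Iy _) := hfPsi (y - t) y.
  by rewrite (hE _ yt) subKr; apply; [apply: Icd|]; lra.
have dF (t : R) : 0 <= t <= y - x -> is_derive (y - t) (1 : R) F (f (y - t)).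
  by move=> tL; apply: (is_derive_primitive cf); lra.
have dh (t : R) : 0 < t <= y - x -> is_derive t (1 : R) h ((f (y - t) - h t) / t).
  by move=> tL; apply: is_derive_difference_quotient; [|apply: dF]; lra.
have iPsi (r : R) : 0 <= r -> (@completed_lebesgue_measure R).-integrable `[r, y - x]
    (EFin \o (fun t => Psi t / t)).
  move=> r0; apply: hPsi => t /=; rewrite in_itv/= => /andP[rt tL].
  split; first exact: le_trans rt.
  by apply: le_lt_trans (width _ _ Ix Iy); rewrite lee_fin.
(* The increment starts at [r > 0] because [h 0] is the default value 0, not [f y]. The bound is
   enlarged to an integral from 0 to make it independent of [r]. *)
have hJ (r : R) : 0 < r < y - x -> `|h (y - x) - h r| <= J 0 (y - x).
  move=> rL; apply: (@le_trans _ _ (J r (y - x))).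
    apply: norm_increment_le_Rintegral (fun t => (f (y - t) - h t) / t) _ _ _ _ _ _ _ _.
    - by lra.
    - by move=> t; rewrite in_itv/= => rt; apply: dh; lra.
    (* The derivative is continuous: [y - t] stays in []c, d[], [h] is derivable, and [t >= r] keeps
       the denominator away from 0. *)
    - apply: continuous_in_subspaceT => t /[1!inE] /=; rewrite in_itv/= => rt.
      have fyt : {for y - t, continuous f}.
        move: hfo => /(_ (y - t)); apply; rewrite inE/= in_itv/=; lra.
      have [dht _] : is_derive t (1 : R) h ((f (y - t) - h t) / t).
        by apply: dh; lra.
      apply: cvgM; last by apply: cvgV; [rewrite gt_eqF//; lra|exact: cvg_id].
      apply: cvgB; last exact/differentiable_continuous/derivable1_diffP.
      apply: (cvg_comp (fun s => y - s) f) fyt.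
      by apply: cvgB; [exact: cvg_cst|exact: cvg_id].
    - by apply: iPsi; lra.
    - move=> t; rewrite in_itv/= => rt.
      have t0 : 0 < t by lra.
      by rewrite normrM normfV (gtr0_norm t0) ler_pM2r ?invr_gt0// fh//; lra.
  have r0 : 0 <= r by lra.
  rewrite /J /Rintegral fine_le ?integrable_fin_num ?iPsi//=;
    [exact: sub_caratheodory|exact: sub_caratheodory|].
  (* [Psi t / t] is nonnegative on [[0, y - x]], so its integral grows with the domain. *)
  apply: ge0_subset_integral => //=.
  - exact: sub_caratheodory.
  - exact: sub_caratheodory.
  - by case/integrableP : (iPsi 0 (lexx _)).
  - move=> t; rewrite in_itv/= lee_fin => /andP[t0 tL].
    rewrite divr_ge0// hPsi0//; split=> //.
    by rewrite (le_lt_trans _ (width _ _ Ix Iy))// lee_fin.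
  - by apply: subset_itvr; rewrite bnd_simp; lra.
have hJ0 : `|h (y - x) - f y| <= J 0 (y - x).
  have dFy : is_derive y (1 : R) F (f y).
    by have := dF 0; rewrite subr0; apply; lra.
  have h0 : `|h (y - x) - h t| @[t --> 0^'+] --> `|h (y - x) - f y|.
    apply: cvg_norm; apply: cvgB; first exact: cvg_cst.
    exact: cvg_difference_quotient dFy.
  (* The bound is uniform in [t], hence survives the limit [t --> 0^'+], where [h t] tends to
     [f y]. *)
  apply: (cvgr_to_le h0).
  near=> t; apply: hJ; apply/andP; split; first by near: t; exact: nbhs_right_gt.
  by near: t; apply: nbhs_right_lt; rewrite subr_gt0.
rewrite (distrC x) (gtr0_norm (_ : 0 < y - x)) ?subr_gt0//.
rewrite hPhi ?subr_gt0//; last exact: width.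
rewrite -(subrKA (h (y - x))) (le_trans (ler_normD _ _))// lerD//.
by have := fh (y - x); rewrite subKr; apply; lra.
Unshelve. all: by end_near. Qed.
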